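(* For every sufficiently large integer $n$ the following holds for the unbiased (i.e. $(1:1)$) Walker-Breaker game on $K_n$: Walker has a strategy to create a cycle of length $n-2$ (that is, to have all edges of some cycle of length $n-2$ in her graph), while Breaker, playing as the first player, has a strategy that prevents Walker from creating any cycle of length larger than $n-2$.
   Context: A $(1:b)$ Walker-Breaker game on $K_n$ is played as follows. Walker and Breaker alternately claim edges of the complete graph $K_n$. At every moment Walker has a position, a vertex $v$ (initially a start vertex of her choice). In her move Walker must choose an edge $vw$ incident with her current position $v$ which has not been claimed by Breaker (it may have been claimed by Walker before); she claims this edge (if not already hers) and $w$ becomes her new position. In each of his moves Breaker claims $b$ edges not claimed by either player so far, without any further restriction. Walker's graph is the graph formed by the edges she has claimed; Walker creates a structure if her graph contains it. The unbiased game is the case $b=1$. *)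

(* Defs.v *)
From mathcomp Require Import all_boot.

Set Implicit Arguments.
Unset Strict Implicit.
Unset Printing Implicit Defensive.

Inductive player := Walker | Breaker.

Definition opponent (p : player) : player :=
  if p is Walker then Breaker else Walker.

(* Turns are numbered from 0. *)
Definition turn (first : player) (t : nat) : player :=
  if odd t then opponent first else first.

(* The vertex set of K_n is 'I_n, and an edge is a set of two vertices. *)
Definition Kn_edges (n : nat) : {set {set 'I_n}} :=
  [set e : {set 'I_n} | #|e| == 2].

Record state (n : nat) := State {
  wpos : 'I_n;
  wedges : {set {set 'I_n}};
  bedges : {set {set 'I_n}}
}.

Definition initial (n : nat) (v0 : 'I_n) : state n := State v0 set0 set0.

Definition free_edges (n : nat) (s : state n) : {set {set 'I_n}} :=
  Kn_edges n :\: (wedges s :|: bedges s).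

Definition walkable (n : nat) (s : state n) (w : 'I_n) : bool :=
  (w != wpos s) && ([set wpos s; w] \notin bedges s).

(* A move of Walker is given by her new position. If Breaker has claimed every
   edge at her position she is stuck for good: staying put then counts as her
   only legal move. *)
Definition walker_legal (n : nat) (s : state n) (w : 'I_n) : bool :=
  if [exists u, walkable s u] then walkable s w else w == wpos s.

Definition walker_step (n : nat) (s : state n) (w : 'I_n) : state n :=
  State w
    (if w == wpos s then wedges s else [set wpos s; w] |: wedges s)
    (bedges s).

(* When fewer than b edges are free, Breaker takes all of them. *)
Definition breaker_legal (n b : nat) (s : state n) (F : {set {set 'I_n}}) :
    bool :=
  (F \subset free_edges s) && (#|F| == minn b #|free_edges s|).

Definition breaker_step (n : nat) (s : state n) (F : {set {set 'I_n}}) :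
    state n :=
  State (wpos s) (wedges s) (F :|: bedges s).

(* A play is the infinite sequence of its states: p t is the state before turn
   t. Once no edge is free, neither player's graph changes any more. *)
Definition history (n : nat) (p : nat -> state n) (t : nat) : seq (state n) :=
  mkseq p t.+1.

Definition walker_strategy (n : nat) := seq (state n) -> 'I_n.
Definition breaker_strategy (n : nat) := seq (state n) -> {set {set 'I_n}}.

Definition play_vs_walker (n b : nat) (first : player) (v0 : 'I_n)
    (sigma : walker_strategy n) (p : nat -> state n) : Prop :=
  p 0 = initial v0 /\
  forall t : nat,
    match turn first t with
    | Walker => p t.+1 = walker_step (p t) (sigma (history p t))
    | Breaker => exists2 F, breaker_legal b (p t) F
                          & p t.+1 = breaker_step (p t) F
    end.

Definition play_vs_breaker (n : nat) (first : player) (v0 : 'I_n)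
    (tau : breaker_strategy n) (p : nat -> state n) : Prop :=
  p 0 = initial v0 /\
  forall t : nat,
    match turn first t with
    | Walker => exists2 w, walker_legal (p t) w & p t.+1 = walker_step (p t) w
    | Breaker => p t.+1 = breaker_step (p t) (tau (history p t))
    end.

(* Walker chooses her start vertex before the first turn, whoever moves first.
   A winning strategy is required to make only legal moves. *)
Definition walker_can_create (n b : nat) (first : player)
    (goal : {set {set 'I_n}} -> Prop) : Prop :=
  exists (v0 : 'I_n) (sigma : walker_strategy n),
  forall p : nat -> state n, play_vs_walker b first v0 sigma p ->
    (forall t : nat, turn first t = Walker ->
       walker_legal (p t) (sigma (history p t))) /\
    exists t : nat, goal (wedges (p t)).

Definition breaker_can_prevent (n b : nat) (first : player)
    (goal : {set {set 'I_n}} -> Prop) : Prop :=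
  exists tau : breaker_strategy n,
  forall (v0 : 'I_n) (p : nat -> state n), play_vs_breaker first v0 tau p ->
    (forall t : nat, turn first t = Breaker ->
       breaker_legal b (p t) (tau (history p t))) /\
    forall t : nat, ~ goal (wedges (p t)).

Definition has_cycle (n k : nat) (E : {set {set 'I_n}}) : Prop :=
  3 <= k /\
  exists2 c : seq 'I_n,
    size c = k & ucycle [rel x y | [set x; y] \in E] c.

(* Main.v *)
Require Import Defs.
From mathcomp Require Import all_boot zify.

(** Breaker fixes a vertex [u] and answers each step of Walker by joining her
    position to [u], so that [u] stays unvisited. When only [u] and one more
    vertex [z] are unvisited, he protects [z] in the same way instead. At that
    moment all edges at [u] except two, [uz] and the one to Walker's position,
    are his, so [u] keeps degree at most one in Walker's graph and lies on no
    cycle, and [z] is never visited.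

    Walker first builds a short path starting at [a] and rotates it at its other
    end, which gives 110 vertices [s] joined to [a] by a path of her graph
    through all her vertices. She walks back to [a] and prolongs these paths
    greedily. Meanwhile at most one unvisited vertex [w] gets a degree above
    [n / 100] in Breaker's graph: as soon as [w] is heavy, Walker only steps to
    vertices from which she threatens to enter [w], which leaves Breaker no
    other move. When few vertices remain she closes the path to one of the 110
    vertices, and then inserts the remaining vertices into the cycle one at a
    time. Each insertion starts from a cycle vertex [v] such that two outside
    vertices are both still joinable to [v] and to its two neighbours: one move
    of Breaker can spoil neither both vertices nor both neighbours. *)

Set Implicit Arguments.
Unset Strict Implicit.
Unset Printing Implicit Defensive.

(** * Breaker's degrees and Hamiltonian paths of Walker *)

Section Graph.
Variable V : finType.
Local Notation edges := {set {set V}}.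
Implicit Types (B W : edges) (X S : {set V}).

Definition adj W : rel V := [rel x y | [set x; y] \in W].

Lemma adj_sym W : symmetric (adj W).
Proof. by move=> x y; rewrite /adj /= setUC. Qed.

Lemma set2_injr (v x y : V) : [set v; x] = [set v; y] -> x = y.
Proof.
move=> /setP E; have:= E x; rewrite !inE eqxx orbT => /esym/orP[]/eqP // xv.
by have:= E y; rewrite !inE eqxx orbT xv orbb => /eqP.
Qed.

Definition nb B (v : V) : {set V} := [set u | [set v; u] \in B].

Lemma in_nb B v u : (u \in nb B v) = ([set v; u] \in B).
Proof. by rewrite inE. Qed.

Definition deg B (v : V) : nat := #|[set e in B | v \in e]|.

Lemma card_nb B v : #|nb B v| <= deg B v.
Proof.
rewrite /deg -(card_in_imset (f := fun u => [set v; u]) (D := nb B v)).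
  apply: subset_leq_card; apply/subsetP => _ /imsetP[u + ->].
  by rewrite !inE eqxx andbT.
by move=> x y _ _; exact: set2_injr.
Qed.

Lemma deg_le_card B v : deg B v <= #|B|.
Proof. by apply/subset_leq_card/subsetP => e; rewrite inE => /andP[]. Qed.

Lemma handshake B : B \subset [set e : {set V} | #|e| == 2] -> \sum_v deg B v = 2 * #|B|.
Proof.
move=> sB; under eq_bigr => v _ do rewrite /deg -sum1_card big_mkcond.
rewrite exchange_big /=.
rewrite (eq_bigr (fun e => if e \in B then 2 else 0)); last first.
  move=> e _; case: ifP => eB; last first.
    by rewrite big1 // => v _; rewrite inE eB.
  have := subsetP sB _ eB; rewrite inE => /eqP <-.
  rewrite -sum1_card [RHS]big_mkcond /=.
  by apply: eq_bigr => v _; rewrite inE eB.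
by rewrite -big_mkcond /= sum_nat_const mulnC.
Qed.

(** Markov's inequality for the degree sum: with few edges Breaker makes only few vertices heavy. *)
Lemma heavy_count B X d : B \subset [set e : {set V} | #|e| == 2] ->
  #|[set v in X | d <= deg B v]| * d <= 2 * #|B|.
Proof.
move=> sB; rewrite -(handshake sB) -sum_nat_const.
rewrite [leqRHS](bigID (mem [set v in X | d <= deg B v])) /=.
apply: leq_trans (leq_addr _ _).
by apply: leq_sum => v; rewrite inE => /andP[].
Qed.

Lemma ex_notin (A : {set V}) X : #|A| < #|X| -> exists2 v, v \in X & v \notin A.
Proof.
move=> lt; have /subsetPn[v vX vA] : ~~ (X \subset A).
  by apply: contraL lt => /subset_leq_card; rewrite leqNgt.
by exists v.
Qed.

(* One move of Breaker, who claims no edge when none is free. *)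
Definition grow B B' : Prop :=
  exists e : {set V}, B \subset B' /\ B' \subset e |: B.

Lemma grow_card B B' : grow B B' -> #|B'| <= #|B|.+1.
Proof.
case=> e [_ /subset_leq_card]; rewrite cardsU1 => le.
by apply: leq_trans le _; rewrite -add1n leq_add2r leq_b1.
Qed.

Lemma grow_deg B B' v : grow B B' -> deg B' v <= (deg B v).+1.
Proof.
case=> e [_ /subsetP sB].
apply: leq_trans (_ : #|e |: [set f in B | v \in f]| <= _).
  apply/subset_leq_card/subsetP => f; rewrite !inE => /andP[/sB].
  by rewrite !inE => /orP[->//|->] ->; rewrite orbT.
by rewrite cardsU1 -add1n leq_add2r leq_b1.
Qed.

Lemma grow_deg_le B B' v : grow B B' -> deg B v <= deg B' v.
Proof.
case=> e [/subsetP sB _]; apply/subset_leq_card/subsetP => f.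
by rewrite !inE => /andP[/sB-> ->].
Qed.

Lemma grow_nbD B B' v X : grow B B' ->
  #|nb B' v :\: X| <= #|nb B v :\: X|.+1.
Proof.
case=> e [_ /subsetP sB].
apply: leq_trans (_ : #|(nb B v :\: X) :|: [set u | [set v; u] == e]| <= _).
  apply/subset_leq_card/subsetP => u; rewrite !inE => /andP[-> /sB].
  by rewrite !inE orbC.
apply: leq_trans (leq_card_setU _ _) _; rewrite -addn1 leq_add2l.
by apply/card_le1P => x; rewrite inE => /eqP E y; rewrite !inE -E; apply/eqP/eqP => [/set2_injr|->].
Qed.

Lemma grow_two B B' e f : grow B B' -> e \notin B -> f \notin B -> e != f ->
  e \notin B' \/ f \notin B'.
Proof.
case=> g [_ /subsetP sB] eB fB ef.
case: (boolP (e \in B')) => [/sB|]; last by left.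
rewrite !inE (negbTE eB) orbF => /eqP eg; right.
by apply/negP => /sB; rewrite !inE (negbTE fB) orbF -eg eq_sym (negbTE ef).
Qed.

(** One newly claimed edge determines Breaker's whole move, so degrees away from it do not rise. *)
Lemma grow_eq B B' f : grow B B' -> f \notin B -> f \in B' -> B' = f |: B.
Proof.
case=> g [/subsetP sB /subsetP sB'] fB fB'.
have := sB' _ fB'; rewrite !inE (negbTE fB) orbF => /eqP fg.
apply/setP => e; apply/idP/idP => [/sB'|]; first by rewrite fg.
by rewrite !inE => /orP[/eqP->|/sB].
Qed.

Definition ok W B : Prop := B \subset [set e : {set V} | #|e| == 2] /\ [disjoint W & B].

Lemma ok_notin W B e : ok W B -> e \in W -> e \notin B.
Proof. by case=> _ /disjointFr h /h ->. Qed.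

(* Walker to move at [p] can force her graph to satisfy [G]. *)
Inductive forces (G : edges -> Prop) : V -> edges -> edges -> Prop :=
| forces_now p W B : G W -> forces G p W B
| forces_move p W B w : w != p -> [set p; w] \notin B ->
    (forall B', grow B B' -> ok ([set p; w] |: W) B' ->
       forces G w ([set p; w] |: W) B') ->
    forces G p W B.

(** An edge of Walker is never Breaker's, so she may walk it again; her graph stays the same while
    Breaker gains a move. *)
Lemma forces_walk (G : edges -> Prop) p W B w : ok W B -> adj W p w -> w != p ->
  (forall B', grow B B' -> ok W B' -> forces G w W B') -> forces G p W B.
Proof.
move=> okB pw wp H; apply: (@forces_move _ _ _ _ w) => //; first exact: ok_notin pw.
have -> : [set p; w] |: W = W by apply/setUidPr; rewrite sub1set.
exact: H.
Qed.

(** A Hamiltonian path of [X]; the order of its vertices is hidden because mostly the ends and the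
    vertex set matter. *)
Definition hp W X (a b : V) : Prop :=
  exists q, [/\ path (adj W) a q, last a q = b, uniq (a :: q) & X = [set x in a :: q]].

Lemma sub_path_adj W W' a q : W \subset W' -> path (adj W) a q -> path (adj W') a q.
Proof. by move=> /subsetP sW; apply: sub_path => x y; apply: sW. Qed.

Lemma hp_mono W W' X a b : W \subset W' -> hp W X a b -> hp W' X a b.
Proof. by move=> sW [q [pq lq uq eX]]; exists q; split=> //; exact: sub_path_adj pq. Qed.

Lemma hp_sym W X a b : hp W X a b -> hp W X b a.
Proof.
case=> q [pq lq uq eX]; exists (rev (belast a q)).
have E : b :: rev (belast a q) = rev (a :: q) by rewrite (lastI a q) rev_rcons lq.
split.
- rewrite -lq rev_path; rewrite (eq_path (e' := adj W)) // => x y; exact: adj_sym.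
- by move: (congr1 (last b) E); rewrite rev_cons last_rcons /=.
- by rewrite E rev_uniq.
- by rewrite eX; apply/setP => x; rewrite !in_set E mem_rev.
Qed.

Lemma hp_ext W X a b y : hp W X a b -> y \notin X ->
  hp ([set b; y] |: W) (y |: X) a y.
Proof.
case=> q [pq lq uq eX] yX; exists (rcons q y); split.
- rewrite rcons_path (sub_path_adj (subsetUr _ _) pq) /= lq.
  by rewrite /adj /= setU11.
- by rewrite last_rcons.
- by rewrite -rcons_cons rcons_uniq uq andbT; move: yX; rewrite eX inE.
- by rewrite eX; apply/setP => x; rewrite !inE mem_rcons !inE; do ![case: (_ == _) => //=].
Qed.

(* Posa rotation along the chord from the end [b] to [y]. *)
Lemma hp_rot W a b q1 y z q2 :
  path (adj W) a q1 -> last a q1 = y ->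
  path (adj W) y (z :: q2) -> last z q2 = b -> uniq (a :: q1 ++ z :: q2) ->
  hp ([set b; y] |: W) [set x in a :: q1 ++ z :: q2] a z.
Proof.
move=> p1 l1 /= /andP[yz p2] l2 u.
exists (q1 ++ rev (z :: q2)); split.
- rewrite cat_path (sub_path_adj (subsetUr _ _) p1) /= l1.
  rewrite lastI rev_rcons /= l2; apply/andP; split.
    by rewrite /adj /= [[set y; b]]setUC setU11.
  apply: sub_path_adj (subsetUr _ _) _; rewrite -l2 rev_path.
  by rewrite (eq_path (e' := adj W)) // => s t; exact: adj_sym.
- by rewrite last_cat rev_cons last_rcons.
- by rewrite -cat_cons cat_uniq rev_uniq (eq_has_r (mem_rev _)) -cat_uniq.
- by apply/setP => x; rewrite !inE !mem_cat mem_rev.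
Qed.

Lemma hp_end W X a b : hp W X a b -> b \in X.
Proof. by case=> q [_ <- _ ->]; rewrite inE mem_last. Qed.

Lemma hp_start W X a b : hp W X a b -> a \in X.
Proof. by move/hp_sym/hp_end. Qed.

(** Walker retraces the path edge by edge. This takes fewer moves than [X] has vertices, and each
    gives Breaker one edge. *)
Lemma forces_walk_back (G : edges -> Prop) W X a b B : hp W X a b -> ok W B ->
  (forall B', ok W B' -> #|B'| <= #|B| + #|X| -> forces G a W B') ->
  forces G b W B.
Proof.
case=> q [pq lq uq ->]; elim/last_ind: q b B pq lq uq => [|q c IH] b B pq lq uq okB H.
  by move: lq => /= <-; apply: H => //; exact: leq_addr.
move: lq; rewrite last_rcons => <-{b}.
move: pq; rewrite rcons_path => /andP[pq lc].
move: uq; rewrite -rcons_cons rcons_uniq => /andP[cq uq].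
apply: (@forces_walk _ _ _ _ (last a q)) => //.
- by rewrite adj_sym.
- by apply: contraNneq cq => <-; exact: mem_last.
move=> B' gB okB'; apply: IH => // B'' okB'' le; apply: H => //.
have sz : forall r : seq V, uniq r -> #|[set x in r]| = size r.
  by move=> r /card_uniqP <-; apply: eq_card => x; rewrite inE.
have := grow_card gB; move: le; rewrite !sz //.
  by rewrite /= size_rcons; lia.
by rewrite -rcons_cons rcons_uniq cq.
Qed.

End Graph.

(** * Inserting vertices into a cycle *)

Section Absorb.
Variable V : finType.
Local Notation edges := {set {set V}}.
Implicit Types (B W : edges) (X S : {set V}).

Lemma card_setU_le X S : #|X :|: S| <= #|X| + #|S|.
Proof. exact: (leq_card_setU X S).1. Qed.

Lemma card_setC_U1 X y : #|~: X| <= #|~: (y |: X)|.+1.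
Proof.
have := cardsC X; have := cardsC (y |: X); rewrite cardsU1.
by have := leq_b1 (y \notin X); clear; lia.
Qed.

Lemma sub_ucycle_adj W W' (c : seq V) : W \subset W' ->
  ucycle (adj W) c -> ucycle (adj W') c.
Proof.
move=> /subsetP sW /andP[cc uc]; rewrite /ucycle uc andbT.
by apply: sub_cycle cc => x y; apply: sW.
Qed.

Lemma cycle_insert W (c : seq V) x u : ucycle (adj W) c -> x \in c -> u \notin c ->
  adj W x u -> adj W u (next c x) ->
  exists2 c', ucycle (adj W) c' & c' =i u :: c.
Proof.
move=> /andP[cc uc] xc unc xu ux; have [i s rs] := rot_to xc.
have us : uniq (x :: s) by rewrite -rs rot_uniq.
have cs : cycle (adj W) (x :: s) by rewrite -rs rot_cycle.
have ms : x :: s =i c by move=> y; rewrite -rs mem_rot.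
have nx : next c x = head x s.
  by rewrite -(next_rot i) // rs /=; case: (s) => [|y s'] /=; rewrite eqxx.
exists (x :: u :: s); last first.
  by move=> y; rewrite [RHS]inE -ms !inE orbCA.
apply/andP; split.
  rewrite nx in ux; rewrite /= xu /=; case: (s) cs ux => [|y s'] /=; first by move=> _ ->.
  by move=> /andP[_ ->] ->.
have : u \notin x :: s by rewrite ms.
rewrite inE => /norP[nux us']; move: us => /= /andP[xs ->].
by rewrite inE negb_or eq_sym nux xs us'.
Qed.

Lemma card_mem_uniq (c : seq V) : uniq c -> #|[set x in c]| = size c.
Proof. by move=> /card_uniqP <-; apply: eq_card => x; rewrite inE. Qed.

Lemma card_preim_inj (f : V -> V) (A : {set V}) : injective f -> #|f @^-1: A| <= #|A|.
Proof.
move=> fI; rewrite -(card_imset _ fI); apply/subset_leq_card/subsetP.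
by move=> _ /imsetP[x + ->]; rewrite inE.
Qed.

(** After a rotation that puts [v] first, its successor is the second vertex and its predecessor the
    last one. *)
Lemma next_neq_prev (c : seq V) v : uniq c -> v \in c -> 2 < size c ->
  next c v != prev c v.
Proof.
move=> uc vc; have [i s rs] := rot_to vc.
rewrite -(next_rot i) // -(prev_rot i) // -(size_rot i) rs.
have : uniq (v :: s) by rewrite -rs rot_uniq.
case: s {rs} => [|x [|y s]] //= /and3P[vs xs us] _; rewrite eqxx.
have /negbTE-> : v != x by apply: contraNneq vs => ->; rewrite inE eqxx.
have h : forall z t, v \notin t -> prev_at v v z t = last z t.
  move=> z t; elim: t z => [|a t IH] z /=; first by rewrite eqxx.
  by rewrite inE => /norP[/negbTE-> /IH].
rewrite -[X in _ != X]/(prev_at v v x (y :: s)) h.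
  by apply: contraNneq xs => /= ->; exact: mem_last.
by apply: contra vs => vys; rewrite in_cons vys orbT.
Qed.

Definition clean B (c : seq V) (v u : V) : bool :=
  [&& [set u; v] \notin B, [set u; next c v] \notin B & [set u; prev c v] \notin B].

(** No edge from [u1] to the cycle is also one from [u2], as both vertices are off the cycle;
    Breaker's single edge harms only one of them. *)
Lemma grow_clean B B' (c : seq V) v u1 u2 : grow B B' -> v \in c ->
  u1 \notin c -> u2 \notin c -> u1 != u2 -> clean B c v u1 -> clean B c v u2 ->
  clean B' c v u1 \/ clean B' c v u2.
Proof.
move=> gB vc u1c u2c u12 /and3P[a1 b1 d1] /and3P[a2 b2 d2].
case: (boolP (clean B' c v u1)) => [|nc]; [by left | right].
have neq x y : x \in c -> y \in c -> [set u1; x] != [set u2; y].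
  move=> xc yc; apply: contraNneq u1c => /setP/(_ u1).
  by rewrite !inE eqxx (negbTE u12) => /esym/eqP ->.
have key x y : x \in c -> y \in c -> [set u1; x] \notin B -> [set u1; x] \in B' ->
    [set u2; y] \notin B -> [set u2; y] \notin B'.
  move=> xc yc xB xB' yB.
  by have [/negP|] := grow_two gB xB yB (neq _ _ xc yc).
have nC : next c v \in c by rewrite mem_next.
have pC : prev c v \in c by rewrite mem_prev.
move: nc; rewrite /clean !negb_and !negbK => /or3P[] h; apply/and3P; split;
  exact: (key _ _ _ _ _ h).
Qed.

Definition long_cycle W : Prop :=
  exists2 c : seq V, size c = #|V| - 2 & ucycle (adj W) c.

(** Induction on the number [m] of insertions to come. Each takes four moves of either player, so
    the degree budget [D] reserves 4 per insertion. The vertex [w], whose degree is not bounded, is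
    never chosen for insertion. *)
Lemma absorb_all D m p W B (c : seq V) w :
  ok W B -> ucycle (adj W) c -> p \in c -> size c + m.+2 = #|V| ->
  (forall u, u \notin c -> u != w -> deg B u + 4 * m <= D) ->
  deg B p + 4 * m <= D -> 7 * D + 2 < size c ->
  forces long_cycle p W B.
Proof.
elim: m p W B c => [|m IH] p W B c okB cc pc sc dU dp big.
  apply: forces_now; have sz : size c = #|V| - 2 by lia.
  by exists c.
have uc : uniq c by case/andP: cc.
have cU : #|~: [set x in c]| = m.+3.
  by have := cardsC [set x in c]; rewrite card_mem_uniq //; lia.
have [u1 u1c u1w] : exists2 u, u \in ~: [set x in c] & u \notin [set w].
  by apply: ex_notin; rewrite cards1 cU.
have [u2 u2c] : exists2 u, u \in ~: [set x in c] & u \notin [set w; u1].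
  by apply: ex_notin; rewrite cU cards2; case: eqP.
move: u1c u1w u2c; rewrite !inE negb_or => u1c u1w u2c /andP[u2w u21].
have [d1 d2] := (dU _ u1c u1w, dU _ u2c u2w).
have In : injective (next c) by exact: can_inj (prev_next uc).
have Ip : injective (prev c) by exact: can_inj (next_prev uc).
pose bad u := nb B u :|: (next c @^-1: nb B u :|: prev c @^-1: nb B u).
have cbad u : #|bad u| <= 3 * deg B u.
  apply: leq_trans (card_setU_le _ _) _.
  apply: leq_trans (leq_add (leqnn _) (card_setU_le _ _)) _.
  rewrite !mulSn mul0n addn0; apply: leq_add; first exact: card_nb.
  by apply: leq_add; apply: leq_trans (card_preim_inj _ _) (card_nb _ _).
(* The vertex [p] and its neighbours exclude at most [D + 1] vertices and the two bad sets at most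
   [3 * D] each, whence the bound [7 * D + 2]. *)
have [v] : exists2 v, v \in [set x in c] &
    v \notin (p |: nb B p) :|: (bad u1 :|: bad u2).
  apply: ex_notin; rewrite card_mem_uniq //.
  have := card_setU_le (p |: nb B p) (bad u1 :|: bad u2).
  have := card_setU_le (bad u1) (bad u2); have := cbad u1; have := cbad u2.
  have := card_setU_le [set p] (nb B p); rewrite cards1.
  have := card_nb B p; lia.
have badE u : (v \notin bad u) = clean B c v u.
  by rewrite /clean !inE !negb_or.
rewrite in_set => vc; rewrite in_setU negb_or in_setU1 negb_or in_setU negb_or !badE.
case/andP=> /andP[vp pv] /andP[cl1 cl2]; rewrite in_nb in pv.
apply: (forces_move vp pv) => B1 g1 ok1.
have [u [uc' uw clu]] : exists u, [/\ u \notin c, u != w & clean B1 c v u].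
  have [] := grow_clean g1 vc u1c u2c _ cl1 cl2; first by rewrite eq_sym.
    by exists u1.
  by exists u2.
have du := dU _ uc' uw.
have vu : u != v by apply: contraNneq uc' => ->.
case/and3P: clu => clv cln clp.
apply: (forces_move vu); first by rewrite setUC.
move=> B2 g2 ok2; set W2 := _ |: (_ |: W) in ok2 *.
have fin z W3 : W3 = [set u; z] |: W2 -> z \in c -> [set u; z] \notin B2 ->
    (exists2 c', ucycle (adj W3) c' & c' =i u :: c) ->
    forces long_cycle u W2 B2.
  move=> W3E zc uzB [c' cc' mc'].
  have zu : z != u by apply: contraNneq uc' => <-.
  apply: (forces_move zu uzB); rewrite -W3E => B3 g3 ok3.
  (* Walker returns to [u], whose degree is bounded since it was outside the cycle; nothing is known
     about the degree of [z]. *)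
  apply: (@forces_walk _ _ _ _ _ u) => //; first by rewrite adj_sym /adj W3E /= setU11.
    by rewrite eq_sym.
  move=> B4 g4 ok4.
  have sz : size c' = (size c).+1.
    have uc'' : uniq c' by case/andP: cc'.
    rewrite -(card_mem_uniq uc'') -[RHS]/(size (u :: c)) -(@card_mem_uniq (u :: c)) /= ?uc' //.
    by apply: eq_card => x; rewrite !in_set mc'.
  have dg x : deg B4 x <= (deg B x) + 4.
    have := grow_deg x g1; have := grow_deg x g2.
    by have := grow_deg x g3; have := grow_deg x g4; clear; lia.
  apply: (IH _ _ _ c') => //.
  - by rewrite mc' inE eqxx.
  - by rewrite sz addSnnS.
  - move=> x; rewrite mc' inE => /norP[_ xc] xw.
    by have := dU _ xc xw; have := dg x; clear; lia.
  - by have := dg u; move: du; clear; lia.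
  - by rewrite sz; exact: ltnW.
have sW2 : W \subset W2 by rewrite /W2 setUA subsetUr.
have vuW z : adj ([set u; z] |: W2) v u by rewrite /adj /= /W2 !inE eqxx orbT.
have npv : next c v != prev c v by rewrite next_neq_prev //; move: big; clear; lia.
have [h|h] : [set u; next c v] \notin B2 \/ [set u; prev c v] \notin B2.
- by apply: grow_two g2 cln clp _; apply: contraNneq npv => /set2_injr ->.
- apply: (fin (next c v) _ erefl) => //; first by rewrite mem_next.
  apply: (@cycle_insert _ c v u) => //.
    exact: sub_ucycle_adj (subset_trans sW2 (subsetUr _ _)) cc.
  by rewrite /adj /= setU11.
- apply: (fin (prev c v) _ erefl) => //; first by rewrite mem_prev.
  apply: (@cycle_insert _ c (prev c v) u) => //.
  + exact: sub_ucycle_adj (subset_trans sW2 (subsetUr _ _)) cc.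
  + by rewrite mem_prev.
  + by rewrite adj_sym /adj /= setU11.
  + by rewrite next_prev // adj_sym.
Qed.

End Absorb.

(** * Prolonging and closing a path *)

Section Extend.
Variable V : finType.
Local Notation edges := {set {set V}}.
Implicit Types (B W : edges) (X S : {set V}).

Lemma hp_cycle W X s p : hp W X s p -> adj W p s ->
  exists2 c, ucycle (adj W) c & X = [set x in c].
Proof.
case=> q [pq lq uq eX] ps; exists (s :: q) => //.
by rewrite /ucycle uq andbT /= rcons_path pq lq.
Qed.

(** Walker enters the light vertex [y]. Even after Breaker's reply [S] is larger than his
    neighbourhood of [y], so some [s] closes the cycle. She then steps back to [y], whose degree is
    bounded. These three moves account for the 3 in the degree bounds. *)
Lemma close_path D m p W B X S w y :
  ok W B -> (forall s, s \in S -> hp W X s p) -> y \notin X ->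
  [set p; y] \notin B -> deg B y + 2 <= #|S| -> #|X| + m.+3 = #|V| ->
  (forall u, u \notin X -> u != w -> deg B u + 3 + 4 * m <= D) ->
  deg B y + 3 + 4 * m <= D -> 7 * D + 2 < #|X|.+1 ->
  forces (@long_cycle V) p W B.
Proof.
move=> okB hS yX py dS cX dU dy big.
have [s0 s0S _] : exists2 s, s \in S & s \notin set0.
  by apply: ex_notin; rewrite cards0; move: dS; clear; lia.
have pX := hp_end (hS _ s0S).
have yp : y != p by apply: contraNneq yX => ->.
apply: (forces_move yp py) => B1 g1 ok1.
have [s sS sB] : exists2 s, s \in S & s \notin nb B1 y.
  apply: ex_notin; have := card_nb B1 y; have := grow_deg y g1; move: dS.
  by clear; lia.
have sX := hp_start (hS _ sS).
have sy : s != y by apply: contraNneq yX => <-.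
rewrite in_nb in sB; apply: (forces_move sy sB) => B2 g2 ok2.
apply: (@forces_walk _ _ _ _ _ y) => //.
- by rewrite adj_sym /adj /= setU11.
- by rewrite eq_sym.
move=> B3 g3 ok3; set W2 := _ |: (_ |: W) in ok3 *.
have [c cc cE] : exists2 c, ucycle (adj W2) c & y |: X = [set x in c].
  apply: hp_cycle (hp_mono _ (hp_ext (hS _ sS) yX)) _; first exact: subsetUr.
  by rewrite /adj /= setU11.
have mc x : (x \in c) = (x == y) || (x \in X).
  by have := in_setU1 x y X; rewrite cE inE.
have sz : size c = #|X|.+1.
  by rewrite -card_mem_uniq -?cE ?cardsU1 ?yX //; case/andP: cc.
have dg x : deg B3 x <= (deg B x) + 3.
  have := grow_deg x g1; have := grow_deg x g2; have := grow_deg x g3.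
  by clear; lia.
apply: (@absorb_all _ D m _ _ _ c w) => //.
- by rewrite mc eqxx.
- by rewrite sz addSnnS.
- move=> u; rewrite mc => /norP[_ uX] uw.
  by have := dU _ uX uw; have := dg u; clear; lia.
- by have := dg y; move: dy; clear; lia.
- by rewrite sz.
Qed.

(** * Keeping all unvisited vertices but one light *)

Definition heavy T B X : nat := #|[set v in X | T <= deg B v]|.

(** An open threat means that Breaker may have spent his last move elsewhere; the boolean is added
    to the degree bounds as 0 or 1. *)
Definition open_threat T B (p w : V) : bool :=
  ([set p; w] \notin B) && (T <= deg B w).

(* Only [w] may have large degree in Breaker's graph. Breaker must answer every
   step of Walker by an edge to [w] as soon as [w] is heavy: otherwise Walker
   visits [w] at once, which happens at most [heavy] times. *)
Definition guarded T B X p w : Prop :=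
  [/\ w \notin X,
      forall u, u \notin X -> u != w ->
        deg B u <= T + 2 * heavy T B X + open_threat T B p w,
      #|nb B w :\: X| <= T + 2 * heavy T B X + open_threat T B p w &
      #|nb B p :\: X| <= T + 2 * heavy T B X + 1].

Lemma heavy_grow T B B' X y : grow B B' -> heavy T B X <= heavy T B' (y |: X).
Proof.
move=> g; apply/subset_leq_card/subsetP => v; rewrite !inE => /andP[-> dv].
by rewrite orbT /=; apply: leq_trans dv (grow_deg_le v g).
Qed.

Lemma heavy_grow_lt T B B' X y : grow B B' -> y \notin X -> T <= deg B y ->
  heavy T B X < heavy T B' (y |: X).
Proof.
move=> g yX dy; apply: leq_trans (_ : #|y |: [set v in X | T <= deg B v]| <= _).
  by rewrite cardsU1 inE (negbTE yX).
apply/subset_leq_card/subsetP => v; rewrite !inE => /orP[/eqP->|/andP[-> dv]].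
  by rewrite eqxx; apply: leq_trans dy (grow_deg_le y g).
by rewrite orbT /=; apply: leq_trans dv (grow_deg_le v g).
Qed.

Lemma card_nbD B v X : #|nb B v :\: X| <= deg B v.
Proof. by apply: leq_trans (card_nb B v); apply: subset_leq_card; exact: subsetDl. Qed.

Lemma guarded_all T B X p : (exists w, w \notin X) ->
  (forall u, u \notin X -> deg B u <= T + 2 * heavy T B X) ->
  #|nb B p :\: X| <= T + 2 * heavy T B X + 1 -> exists w, guarded T B X p w.
Proof.
move=> [w wX] dU cp; exists w; split=> //.
  by move=> u uX _; apply: leq_trans (dU _ uX) (leq_addr _ _).
by apply: leq_trans (card_nbD _ _ _) (leq_trans (dU _ wX) (leq_addr _ _)).
Qed.

Lemma nbD_setU1 B v X y : #|nb B v :\: (y |: X)| <= #|nb B v :\: X|.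
Proof. by apply/subset_leq_card/setDS/subsetUr. Qed.

Lemma deg_setU1_notin B (x y z : V) : x \notin [set y; z] ->
  deg ([set y; z] |: B) x = deg B x.
Proof.
move=> h; apply: eq_card => e; rewrite !inE; case: eqVneq => [->|//].
by rewrite !inE in h *; rewrite (negbTE h) !andbF.
Qed.

(** If no unvisited vertex is heavy, any free step is safe. If a heavy [w] can be entered, doing so
    raises [heavy] and loosens the bounds. Otherwise Walker steps to some [y] joinable to [w], and
    Breaker either takes that edge or leaves a threat open. *)
Lemma guarded_step T M (G : edges -> Prop) p W B X w :
  ok W B -> p \in X -> guarded T B X p w ->
  T + 2 * heavy T B X + 2 <= M -> 2 * M + 2 < #|~: X| ->
  (forall y B', y \notin X -> [set p; y] \notin B -> grow B B' ->
     ok ([set p; y] |: W) B' -> (exists w', guarded T B' (y |: X) y w') ->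
     forces G y ([set p; y] |: W) B') ->
  forces G p W B.
Proof.
move=> okB pX gw hM big H.
have ex_new y : exists w', w' \notin y |: X.
  have [v vX vy] : exists2 v, v \in ~: X & v \notin [set y].
    by apply: ex_notin; rewrite cards1; move: big; clear; lia.
  by exists v; rewrite in_setU1 negb_or -in_set1 vy -in_setC.
have go y : y \notin X -> [set p; y] \notin B ->
    (forall B', grow B B' -> ok ([set p; y] |: W) B' ->
       exists w', guarded T B' (y |: X) y w') -> forces G p W B.
  move=> yX py Hy; have yp : y != p by apply: contraNneq yX => ->.
  by apply: (forces_move yp py) => B' gB okB'; apply: H => //; exact: Hy.
case: (boolP [forall u, (u \notin X) ==> (deg B u < T)]) => [/forallP small|].
  have cp : #|nb B p :\: X| <= T + 2 * heavy T B X + 1 by case: gw.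
  have [y yX yp] : exists2 y, y \in ~: X & y \notin nb B p :\: X.
    by apply: ex_notin; move: cp hM big; clear; lia.
  have {}yX : y \notin X by rewrite -in_setC.
  have {}yp : [set p; y] \notin B by move: yp; rewrite in_setD in_nb yX.
  apply: go yp _ => // B' gB okB'; apply: guarded_all => //.
    move=> u; rewrite in_setU1 => /norP[_ uX].
    have := grow_deg u gB; have /implyP/(_ uX) := small u; clear; lia.
  have := card_nbD B' y (y |: X); have := grow_deg y gB.
  by have /implyP/(_ yX) := small y; clear; lia.
rewrite negb_forall => /existsP[w0]; rewrite negb_imply -leqNgt => /andP[w0X dw0].
(* A light [w] carries no threat, so every unvisited vertex obeys the bound and the heavy [w0] can
   replace it. *)
have {w w0 w0X dw0 gw} [w [wX dU cw cp] dw] : exists2 w, guarded T B X p w & T <= deg B w.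
  case: (leqP T (deg B w)) => [dw|dw]; first by exists w.
  case: gw => wX dU cw cp; exists w0 => //.
  have br0 : open_threat T B p w = false by rewrite /open_threat leqNgt dw andbF.
  rewrite br0 addn0 in dU; have dU' u : u \notin X -> deg B u <= T + 2 * heavy T B X.
    by move=> uX; case: (eqVneq u w) => [->|/dU->//]; move: dw; clear; lia.
  split=> //; first by move=> u uX _; apply: leq_trans (dU' _ uX) (leq_addr _ _).
  by apply: leq_trans (card_nbD _ _ _) (leq_trans (dU' _ w0X) (leq_addr _ _)).
case: (boolP ([set p; w] \in B)) => pw; last first.
  have br1 : open_threat T B p w = true by rewrite /open_threat pw dw.
  rewrite br1 /= in dU cw; apply: go pw _ => // B' gB okB'.
  (* The gain of two in the bounds pays for the open threat and for Breaker's reply. *)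
  have lt := heavy_grow_lt gB wX dw.
  apply: guarded_all => //.
    move=> u; rewrite in_setU1 => /norP[uw uX].
    by have := grow_deg u gB; have := dU _ uX uw; move: lt; clear; lia.
  have := grow_nbD w (w |: X) gB; have := nbD_setU1 B w X w.
  by move: cw lt; clear; lia.
have br0 : open_threat T B p w = false by rewrite /open_threat pw.
rewrite br0 addn0 in dU cw.
have [y yX] : exists2 y, y \in ~: X &
    y \notin w |: ((nb B p :\: X) :|: (nb B w :\: X)).
  apply: ex_notin; rewrite cardsU1.
  have := card_setU_le (nb B p :\: X) (nb B w :\: X).
  have := leq_b1 (w \notin (nb B p :\: X) :|: (nb B w :\: X)).
  by move: cw cp hM big; clear; lia.
rewrite in_setC in yX.
rewrite in_setU1 in_setU !in_setD !in_nb yX /= => /norP[yw /norP[py wy]].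
apply: go py _ => // B' gB okB'; exists w.
have le := heavy_grow T X y gB.
have wX' : w \notin y |: X by rewrite in_setU1 negb_or eq_sym yw.
have cy : #|nb B' y :\: (y |: X)| <= T + 2 * heavy T B' (y |: X) + 1.
  have := card_nbD B' y (y |: X); have := grow_deg y gB.
  by have := dU _ yX yw; move: le; clear; lia.
case: (boolP ([set y; w] \in B')) => ywB; last first.
  have br1 : open_threat T B' y w = true.
    by rewrite /open_threat ywB; apply: leq_trans dw (grow_deg_le w gB).
  split; rewrite ?br1 //=.
    move=> u; rewrite in_setU1 => /norP[_ uX] uw.
    by have := grow_deg u gB; have := dU _ uX uw; move: le; clear; lia.
  have := grow_nbD w (y |: X) gB; have := nbD_setU1 B w X y.
  by move: cw le; clear; lia.
have br0' : open_threat T B' y w = false by rewrite /open_threat ywB.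
have ywB0 : [set y; w] \notin B by rewrite setUC.
have eB := grow_eq gB ywB0 ywB.
split; rewrite ?br0' ?addn0 //.
  move=> u; rewrite in_setU1 => /norP[uy uX] uw.
  rewrite {1}eB deg_setU1_notin; last by rewrite !inE negb_or uy uw.
  by have := dU _ uX uw; move: le; clear; lia.
(* Breaker's new edge at [w] ends in [y], which is visited by now and not counted. *)
apply: leq_trans (_ : #|nb B w :\: X| <= _); last by move: cw le; clear; lia.
apply/subset_leq_card/subsetP => u; rewrite {1}eB !in_setD !in_setU1 !in_nb.
case/andP=> /norP[uy ->]; rewrite in_setU1 => /orP[|//].
by rewrite [[set y; w]]setUC => /eqP/set2_injr/eqP; rewrite (negbTE uy).
Qed.

(** Here [k] is about n / 200 and is the threshold for heaviness; [j] counts the steps until [6 * k]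
    vertices remain unvisited. *)
Lemma extend_path k j p W B X S w :
  1000 <= k -> 200 * k <= #|V| <= 201 * k ->
  ok W B -> 110 <= #|S| -> (forall s, s \in S -> hp W X s p) ->
  guarded k B X p w -> #|B| + j <= 202 * k -> #|X| + (6 * k + j) = #|V| ->
  forces (@long_cycle V) p W B.
Proof.
move=> hk /andP[n1 n2] okB cS hS.
have [s0 s0S _] : exists2 s, s \in S & s \notin set0.
  by apply: ex_notin; rewrite cards0; apply: leq_trans cS.
elim: j p W B X w okB hS => [|j IH] p W B X w okB hS gw cB cX.
(* Breaker has at most [202 * k] edges. As [k] is at least 1000, this keeps the bounds in [guarded]
   below [2 * k]. *)
all: have hB : heavy k B X <= 404.
1,3: have := heavy_count X k (proj1 okB); rewrite -/(heavy k B X) => hc;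
  rewrite -(leq_pmul2r (_ : 0 < k)); [move: hc cB; clear; lia | move: hk; clear; lia].
all: have cXC : #|~: X| = #|V| - #|X| by rewrite -(cardsC X) addKn.
  have [wX dU cw cp] := gw.
  (* Fewer than [4 * k] vertices have degree 109 or more, so Walker can reach an unvisited [y] of
     degree at most 108; this is why 110 path ends suffice. *)
  have cH := heavy_count [set: V] 109 (proj1 okB).
  set H := [set v in _ | _] in cH.
  have br := leq_b1 (open_threat k B p w).
  have [y yX] : exists2 y, y \in ~: X & y \notin w |: ((nb B p :\: X) :|: H).
    apply: ex_notin; rewrite cardsU1.
    have := card_setU_le (nb B p :\: X) H.
    have := leq_b1 (w \notin (nb B p :\: X) :|: H).
    by move: cB cp hB hk cXC cX cH; clear; lia.
  rewrite in_setC in yX.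
  rewrite in_setU1 in_setU in_setD in_nb !in_set yX /= => /norP[yw /norP[py]].
  rewrite -ltnNge => dy.
  (* The insertions may add about [24 * k] to a degree that is below [2 * k] so far. *)
  apply: (@close_path (26 * k) (6 * k - 3) p W B X S w y) => //.
  - by move: dy cS; clear; lia.
  - by move: cX hk; clear; lia.
  - by move=> u uX uw; have := dU _ uX uw; move: hB br hk; clear; lia.
  - by move: dy hk; clear; lia.
  - by move: cX n1 hk; clear; lia.
apply: (@guarded_step k (2 * k) _ p W B X w) => //.
- by rewrite (hp_end (hS _ s0S)).
- by move: hB hk; clear; lia.
- by move: cXC cX hk; clear; lia.
move=> y B' yX py gB okB' [w' gw'].
apply: (IH _ _ _ (y |: X) w') => //.
- by move=> s sS; apply: hp_ext yX; exact: hS.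
- by have := grow_card gB; move: cB; clear; lia.
- by rewrite cardsU1 yX; move: cX; clear; lia.
Qed.

End Extend.

(** * Creating many path ends *)

Section Opening.
Variable V : finType.
Local Notation edges := {set {set V}}.
Implicit Types (B W : edges) (X S : {set V}).

Lemma prev_at_cat (x y z : V) q1 q2 : z \notin q1 ->
  prev_at z x y (q1 ++ z :: q2) = last y q1.
Proof.
elim: q1 y => [|t q1 IH] y /=; first by rewrite eqxx.
by rewrite inE => /norP[/negbTE-> /IH].
Qed.

(** Walker crosses from [p] to the predecessor [y] of the intended end [z], then follows the path
    edge to [z]. Breaker gains two edges, so a degree of at most 58 at [z] becomes at most 60. *)
Lemma rotate_ends k r a p W B X S :
  1000 <= k -> 200 * k <= #|V| <= 201 * k -> ok W B ->
  hp W X a p -> (forall s, s \in S -> hp W X a s) ->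
  #|X| = 241 -> #|S| + r = 110 -> deg B p <= 60 -> #|B| + 2 * r <= 462 ->
  forces (@long_cycle V) p W B.
Proof.
move=> hk hn; elim: r p W B S => [|r IH] p W B S okB hX hS cX cS dp cB.
  apply: (forces_walk_back hX okB) => B' okB' cB'.
  (* Breaker has at most 462 + 241 edges after the walk back, fewer than [k]. *)
  have dk v : deg B' v <= k.
    by have := deg_le_card B' v; move: cX cB cB' hk; clear; lia.
  have [w gw] : exists w, guarded k B' X a w.
    apply: guarded_all.
    - have [w wX _] : exists2 w, w \in ~: X & w \notin set0.
        by apply: ex_notin; rewrite cards0 -subn_gt0 subn0;
           have := cardsC X; move: cX hn hk; clear; lia.
      by exists w; rewrite -in_setC.
    - by move=> u _; have := dk u; clear; lia.
    - by have := card_nbD B' a X; have := dk a; clear; lia.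
  apply: (@extend_path _ k (#|V| - (6 * k + 241)) a W B' X S w) => //.
  - by move: cS; clear; lia.
  - by move=> s /hS /hp_sym.
  - by move: cB cB' cX hn hk; clear; lia.
  - by move: cX hn hk; clear; lia.
have [q [pq lq uq eX]] := hX.
have Ip : injective (prev (a :: q)) by exact: can_inj (next_prev uq).
have cH := heavy_count [set: V] 59 (proj1 okB); set H := [set v in _ | _] in cH.
pose P := prev (a :: q) @^-1: nb B p.
have cP : #|P| <= 60.
  exact: leq_trans (card_preim_inj _ Ip) (leq_trans (card_nb B p) dp).
(* At most 110 vertices are excluded by [a] and [S], 15 by [H] and 60 by [P], fewer than 241 in
   all. *)
have [z zX] : exists2 z, z \in X & z \notin (a |: S) :|: (H :|: P).
  apply: ex_notin; have := card_setU_le (a |: S) (H :|: P).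
  have := card_setU_le H P.
  have := leq_b1 (a \notin S); rewrite cardsU1.
  by move: cX cS cP cB cH; clear; lia.
rewrite in_setU in_setU1 in_setU [z \in H]in_set in_setT andTb [z \in P]in_set.
case/norP=> /norP[za zS] /norP[zH zp]; rewrite -ltnNge in zH.
have zq : z \in q by move: zX; rewrite eX in_set inE (negbTE za).
case/splitPr: zq eX pq lq uq zp {Ip P cP} => q1 q2 eX pq lq uq zp.
have zq1 : z \notin q1.
  by move: uq; rewrite cons_uniq cat_uniq /= => /and4P[_ _ /norP[]].
rewrite /= prev_at_cat // in zp.
set y := last a q1 in zp; rewrite in_nb in zp.
move: pq; rewrite cat_path => /andP[p1 p2].
have yz : adj W y z by case/andP: p2.
rewrite last_cat /= in lq.
have yp : y != p.
  move: uq; rewrite -cat_cons cat_uniq => /and3P[_ /hasPn h _].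
  have /h : p \in z :: q2 by rewrite -lq mem_last.
  by apply: contraNneq => <-; exact: mem_last.
have zy : z != y.
  move: uq; rewrite -cat_cons cat_uniq => /and3P[_ /hasPn h _].
  have /h : z \in z :: q2 by rewrite inE eqxx.
  by apply: contraNneq => ->; exact: mem_last.
apply: (forces_move yp zp) => B1 g1 ok1.
have sW : W \subset [set p; y] |: W by exact: subsetUr.
apply: (@forces_walk _ _ _ _ _ z) => //; first exact: (subsetP sW).
move=> B2 g2 ok2.
have hz : hp ([set p; y] |: W) X a z by rewrite eX; exact: (hp_rot p1 _ p2).
apply: (IH _ _ _ (z |: S)) => //.
- by move=> s; rewrite in_setU1 => /orP[/eqP->//|/hS]; exact: hp_mono.
- by rewrite cardsU1 zS; move: cS; clear; lia.
- by have := grow_deg z g1; have := grow_deg z g2; move: zH; clear; lia.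
- by have := grow_card g1; have := grow_card g2; move: cB; clear; lia.
Qed.

(** Walker always steps to a vertex untouched by Breaker, so its degree is at most one after his
    reply. *)
Lemma open_path k j a p W B X :
  1000 <= k -> 200 * k <= #|V| <= 201 * k -> ok W B ->
  hp W X a p -> #|X| + j = 241 -> deg B p <= 1 -> #|B| + j <= 241 ->
  forces (@long_cycle V) p W B.
Proof.
move=> hk hn; elim: j p W B X => [|j IH] p W B X okB hX cX dp cB.
  apply: (@rotate_ends k 110 a p W B X set0) => //.
  - by move=> s; rewrite in_set0.
  - by rewrite -cX addn0.
  - by rewrite cards0.
  - exact: leq_trans dp _.
  - by move: cB; clear; lia.
have cH := heavy_count [set: V] 1 (proj1 okB); set H := [set v in _ | _] in cH.
have [y yX yH] : exists2 y, y \in ~: X & y \notin H.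
  by apply: ex_notin; have := cardsC X; move: cX cB hn hk cH; clear; lia.
rewrite in_setC in yX; rewrite in_set in_setT /= -leqNgt leqn0 in yH.
have yp : y != p by apply: contraNneq yX => ->; exact: hp_end hX.
have py : [set p; y] \notin B.
  apply: contraTN yH => py; rewrite -lt0n card_gt0; apply/set0Pn.
  by exists [set p; y]; rewrite !inE py eqxx orbT.
apply: (forces_move yp py) => B1 g1 ok1.
apply: (IH _ _ _ (y |: X)) => //.
- exact: hp_ext.
- by rewrite cardsU1 yX; move: cX; clear; lia.
- by have := grow_deg y g1; rewrite (eqP yH).
- by have := grow_card g1; move: cB; clear; lia.
Qed.

(** The remainder of n modulo 200 is less than [k], hence n is at most [201 * k]. The possible edge
    in [B] is Breaker's opening move. *)
Lemma walker_forces v B : 200 * 1000 <= #|V| -> ok set0 B -> #|B| <= 1 ->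
  forces (@long_cycle V) v set0 B.
Proof.
move=> hV okB cB; have hd := divn_eq #|V| 200; have hm := ltn_pmod #|V| (isT : 0 < 200).
apply: (@open_path (#|V| %/ 200) 240 v v set0 B [set v]) => //.
- by move: hd hm hV; clear; lia.
- by move: hd hm hV; clear; lia.
- by exists [::]; split=> //; apply/setP => x; rewrite !inE.
- by rewrite cards1.
- exact: leq_trans (deg_le_card B v) cB.
- by move: cB; clear; lia.
Qed.

End Opening.

(** * From forcing to strategies *)

Section WalkerStrategy.
Variable n : nat.
Implicit Types (s : state n) (W B F : {set {set 'I_n}}).

Definition long_cycleb W : bool := [exists c : (n - 2).-tuple 'I_n, ucycleb (adj W) c].

Definition good_move (next_wins : state n -> bool) s (w : 'I_n) : bool :=
  walkable s w && [forall F, breaker_legal 1 (walker_step s w) F ==>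
    next_wins (breaker_step (walker_step s w) F)].

(** A decidable form of [forces] with at most [k] further moves of Walker, from which a strategy is
    found by search. *)
Fixpoint wins k s : bool :=
  long_cycleb (wedges s) || (if k is k'.+1 then [exists w, good_move (wins k') s w] else false).

Lemma wins_leq k k' s : k <= k' -> wins k s -> wins k' s.
Proof.
elim: k k' s => [|k IH] [|k'] s //=; first by rewrite orbF => _ ->.
move=> le /orP[->//|/existsP[w /andP[sw /forallP H]]]; apply/orP; right.
apply/existsP; exists w; rewrite /good_move sw; apply/forallP => F.
by apply/implyP => lF; apply: IH le _; have /implyP/(_ lF) := H F.
Qed.

Lemma legal_grow s F : breaker_legal 1 s F -> grow (bedges s) (F :|: bedges s).
Proof.
case/andP=> _ /eqP cF.
have : #|F| <= 1 by rewrite cF; exact: geq_minl.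
case: (set_0Vmem F) => [->|[e eF]] F1.
  by exists set0; rewrite set0U subxx subsetUr.
exists e; rewrite subsetUr; split=> //; apply: setSU.
by apply/subsetP => f fF; rewrite inE; have /card_le1_eqP/(_ _ _ fF eF)-> := F1.
Qed.

Lemma legal_ok s F : ok (wedges s) (bedges s) -> breaker_legal 1 s F ->
  ok (wedges s) (F :|: bedges s).
Proof.
case=> sB dB /andP[/subsetP sF _]; split.
  by rewrite subUset sB andbT; apply/subsetP => e /sF; rewrite !inE => /andP[].
rewrite disjoint_sym -setI_eq0 setIUl setU_eq0 !setI_eq0.
rewrite [[disjoint bedges s & _]]disjoint_sym dB andbT.
apply/pred0P => e /=; apply/negP => /andP[/sF].
by rewrite !inE => /andP[/norP[/negbTE->]].
Qed.

(** The depth may depend on Breaker's reply; he has finitely many replies, so a maximum exists. *)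
Lemma forces_wins p W B : forces (@long_cycle 'I_n) p W B -> ok W B ->
  exists k, wins k (State p W B).
Proof.
elim=> {p W B} [p W B [c sc cc] _|p W B w wp pw _ IH okB].
  exists 0; rewrite /= orbF; apply/existsP.
  by rewrite card_ord in sc; exists (Tuple (introT eqP sc)).
set s' := State w ([set p; w] |: W) B.
have ok' : ok (wedges s') (bedges s').
  case: okB => sB dB; split=> //=.
  by rewrite -setI_eq0 setIUl setU_eq0 !setI_eq0 dB andbT disjoints1.
have sE : walker_step (State p W B) w = s' by rewrite /walker_step /= (negbTE wp).
have [f fP] : exists f : {set {set 'I_n}} -> nat, forall F,
    breaker_legal 1 s' F -> wins (f F) (breaker_step s' F).
  apply: (fin_all_exists (P := fun F k =>
    breaker_legal 1 s' F -> wins k (breaker_step s' F))) => F.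
  case: (boolP (breaker_legal 1 s' F)) => lF; last by exists 0.
  have okF := legal_ok ok' lF; have gF := legal_grow lF.
  by have [k wk] := IH _ gF okF okF; exists k.
exists (\max_F f F).+1; apply/orP; right; apply/existsP; exists w.
rewrite /good_move sE /walkable /= wp pw /=; apply/forallP => F; apply/implyP => lF.
by apply: wins_leq (fP _ lF); exact: leq_bigmax.
Qed.

Lemma initial_wins (v0 : 'I_n) : 200 * 1000 <= n -> exists K, forall B,
  ok set0 B -> #|B| <= 1 -> wins K (State v0 set0 B).
Proof.
move=> hn; have [f fP] : exists f : {set {set 'I_n}} -> nat, forall B,
    ok set0 B /\ #|B| <= 1 -> wins (f B) (State v0 set0 B).
  apply: (fin_all_exists (P := fun B k =>
    ok set0 B /\ #|B| <= 1 -> wins k (State v0 set0 B))) => B.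
  case: (boolP ((B \subset Kn_edges n) && (#|B| <= 1))) => [/andP[sB cB]|nB].
    have okB : ok set0 B by split=> //; rewrite disjoints_subset sub0set.
    have [|k wk] := @forces_wins v0 set0 B _ okB; last by exists k.
    by apply: walker_forces; rewrite ?card_ord.
  by exists 0 => -[[sB _] cB]; rewrite sB cB in nB.
exists (\max_B f B) => B okB cB; apply: wins_leq (fP _ _); last by split.
exact: leq_bigmax.
Qed.

(** After t turns the history has t + 1 states, and t halved counts Walker's earlier moves, whoever
    began. Without a good move any legal one is taken. *)
Definition winning_strategy K (v0 : 'I_n) : walker_strategy n := fun h =>
  let s := last (initial v0) h in
  if [pick w | good_move (wins (K - (size h).-1./2).-1) s w] is Some w then w
  else if [pick w | walkable s w] is Some w then w else wpos s.

Lemma winning_strategy_legal K v0 h :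
  walker_legal (last (initial v0) h) (winning_strategy K v0 h).
Proof.
rewrite /walker_legal /winning_strategy.
case: pickP => [w /andP[sw _]|_].
  by have -> : [exists u, walkable (last (initial v0) h) u] by apply/existsP; exists w.
case: pickP => [w sw|no].
  by have -> : [exists u, walkable (last (initial v0) h) u] by apply/existsP; exists w.
case: ifP => // /existsP[u]; by rewrite no.
Qed.

Lemma last_history (p : nat -> state n) x t : last x (history p t) = p t.
Proof. by rewrite /history mkseqS last_rcons. Qed.

Lemma walker_creates first : 200 * 1000 <= n ->
  walker_can_create 1 first (fun E => @has_cycle n (n - 2) E).
Proof.
move=> hn; have v0 : 'I_n by apply: (@Ordinal n 0); move: hn; clear; lia.
have [K Kwins] := initial_wins v0 hn.
exists v0, (winning_strategy K v0) => p [p0 pS]; split.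
  by move=> t _; rewrite -[p t](last_history p (initial v0)); exact: winning_strategy_legal.
(* The offset is 1 when Breaker begins, so Walker's turns are those numbered 2j + b. *)
pose b : bool := if first is Breaker then true else false.
have turnW j : turn first (j.*2 + b) = Walker.
  by rewrite /turn oddD odd_double /b; case: (first).
have turnB j : turn first (j.*2 + b).+1 = Breaker.
  by rewrite /turn /= oddD odd_double /b; case: (first).
have ok0 B : B \subset Kn_edges n -> ok set0 B.
  by split=> //; rewrite disjoints_subset sub0set.
have main j : j <= K -> (exists t, long_cycleb (wedges (p t))) \/ wins (K - j) (p (j.*2 + b)).
  elim: j => [_|j IH jK]; first (right; rewrite subn0 double0 add0n).
    rewrite /b; case: (first) pS => pS /=.
      by rewrite p0; apply: Kwins; [apply: ok0; exact: sub0set | rewrite cards0].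
    have /= [F lF ->] := pS 0; rewrite p0 in lF *.
    rewrite /breaker_step /= setU0; case/andP: lF => /subsetP sF /eqP cF.
    apply: Kwins; last by rewrite cF; exact: geq_minl.
    by apply: ok0; apply/subsetP => e /sF; rewrite inE => /andP[].
  have [|] := IH (ltnW jK); first by left.
  set t := j.*2 + b; have -> : K - j = (K - j.+1).+1 by move: jK; clear; lia.
  rewrite /= => /orP[gt|ex]; [by left; exists t | right].
  have := pS t; rewrite turnW => pt; have := pS t.+1; rewrite turnB => -[F lF pt'].
  rewrite doubleS !addSn -/t pt'; move: pt; rewrite /winning_strategy last_history.
  rewrite size_mkseq /=.
  have -> : (K - t./2).-1 = K - j.+1.
    by rewrite /t halfD odd_double doubleK; case: (b); rewrite /= ?add0n ?addn0 subnS.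
  case: pickP => [w /andP[_ /forallP H] pt|no]; last first.
    by case/existsP: ex => w; rewrite no.
  by rewrite pt in lF *; have /implyP/(_ lF) := H F.
have [t gt] : exists t, long_cycleb (wedges (p t)).
  by have [//|] := main K (leqnn K); rewrite subnn /= orbF; exists (K.*2 + b).
exists t; split; first by move: hn; clear; lia.
by case/existsP: gt => c cc; exists (tval c); rewrite ?size_tuple.
Qed.

End WalkerStrategy.

(** * Breaker's strategy *)

Section BreakerStrategy.
Variable n : nat.
Implicit Types (s : state n) (F W B : {set {set 'I_n}}) (X : {set 'I_n}).

(** If [e] is taken, an arbitrary free edge keeps the move legal; an additional edge never hurts
    Breaker. *)
Definition claim s (e : {set 'I_n}) : {set {set 'I_n}} :=
  if e \in free_edges s then [set e]
  else if [pick f in free_edges s] is Some f then [set f] else set0.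

Lemma claim_legal s e : breaker_legal 1 s (claim s e).
Proof.
have free1 f : f \in free_edges s -> breaker_legal 1 s [set f].
  move=> fs; rewrite /breaker_legal sub1set fs cards1 eq_sym; apply/eqP/minn_idPl.
  by rewrite card_gt0; apply/set0Pn; exists f.
rewrite /claim; case: ifP => [/free1//|_]; case: pickP => [f /free1//|no].
rewrite /breaker_legal sub0set cards0 eq_sym (eq_card0 (A := mem (free_edges s))) ?minn0 //.
Qed.

Lemma claim_claims s x y : x != y -> [set x; y] \notin wedges s ->
  [set x; y] \in claim s [set x; y] :|: bedges s.
Proof.
move=> xy nW; rewrite in_setU; case: (boolP (_ \in bedges s)) => nB; first by rewrite orbT.
by rewrite /claim !inE (negbTE nW) (negbTE nB) cards2 xy /= inE eqxx.
Qed.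

Definition visited (h : seq (state n)) : {set 'I_n} := [set x in map (@wpos n) h].

Definition shield (u : 'I_n) X : 'I_n :=
  if #|~: X| <= 2 then odflt u [pick z in ~: X :\ u] else u.

Definition shield_strategy : breaker_strategy n := fun h =>
  if h is s0 :: h' then
    let u := odflt (wpos s0) [pick u | u != wpos s0] in
    let s := last s0 h' in claim s [set shield u (visited h); wpos s]
  else set0.

Definition early u s X : Prop :=
  [/\ 2 < #|~: X|, u \notin X & forall v, v \in X -> v != wpos s -> [set u; v] \in bedges s].

(** Walker may enter [u] in this phase, but only across the edge to [x]. *)
Definition late u s X : Prop :=
  exists x z, [/\ z != u, z \notin X, ~: X \subset [set u; z],
    forall v, v \notin [set u; x; z] -> [set u; v] \in bedges s &
    forall e, e \in wedges s -> z \notin e /\ (u \in e -> e = [set u; x])].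

Definition inv u s X : Prop :=
  [/\ wpos s \in X, forall e, e \in wedges s -> e \subset X & early u s X \/ late u s X].

(** The phase changes when just [u] and some [z] are unvisited; [x] is Walker's position at that
    moment. *)
Lemma early_or_late u s X : wpos s \in X -> (forall e, e \in wedges s -> e \subset X) ->
  u \notin X -> 1 < #|~: X| ->
  (forall v, v \in X -> v != wpos s -> [set u; v] \in bedges s) ->
  early u s X \/ late u s X.
Proof.
move=> pX sW uX; rewrite leq_eqVlt => /orP[/eqP c2|]; last by left.
move=> Bu; right.
have [z zX zu] : exists2 z, z \in ~: X & z \notin [set u].
  by apply: ex_notin; rewrite cards1 -c2.
have UE : ~: X = [set u; z].
  apply/esym/eqP; rewrite eqEcard subUset !sub1set zX in_setC uX -c2 cards2.
  by rewrite eq_sym; rewrite in_set1 in zu; rewrite zu.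
rewrite in_set1 in zu; rewrite in_setC in zX.
exists (wpos s), z; split=> //; first by rewrite UE.
  move=> v; rewrite !inE !negb_or => /andP[/andP[vu vp] vz].
  apply: Bu => //; apply: contraT; rewrite -in_setC UE !inE.
  by rewrite (negbTE vu) (negbTE vz).
move=> e /sW/subsetP eX; split; first by apply: contra zX => /eX.
by move=> /eX; rewrite (negbTE uX).
Qed.

(** The edge from the protected vertex to Walker's position is not hers, since that vertex is
    unvisited. Breaker therefore owns it after his reply and she cannot enter. *)
Lemma inv_step u s X w : inv u s X ->
  let s' := breaker_step s (claim s [set shield u X; wpos s]) in
  walker_legal s' w -> inv u (walker_step s' w) (w |: X).
Proof.
case=> pX sW el s' lw.
have w1 : w = wpos s \/ (w != wpos s /\ [set wpos s; w] \notin bedges s').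
  move: lw; rewrite /walker_legal; case: ifP => _; first by case/andP; right.
  by move/eqP; left.
have pX' : w \in w |: X by rewrite setU11.
have sW' e : e \in wedges (walker_step s' w) -> e \subset w |: X.
  rewrite /=; case: ifP => _; first by move/sW => h; apply: subset_trans h (subsetUr _ _).
  rewrite in_setU1 => /orP[/eqP->|/sW h]; last exact: subset_trans h (subsetUr _ _).
  by rewrite subUset !sub1set pX' in_setU1 pX orbT.
split=> //; case: el => [[c3 uX Bu]|[x [z [zu zX UX Bu Wz]]]].
  have sh : shield u X = u by rewrite /shield leqNgt c3.
  have up : u != wpos s by apply: contraNneq uX => ->.
  have claimed : [set u; wpos s] \in bedges s'.
    rewrite /s' /= sh; apply: claim_claims up _.
    by apply: contra uX => /sW/subsetP; apply; rewrite !inE eqxx.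
  have Bu' v : v \in X -> [set u; v] \in bedges s'.
    move=> vX; case: (eqVneq v (wpos s)) => [->//|vp].
    by rewrite /s' /= in_setU Bu ?orbT.
  have wu : w != u.
    case: w1 => [->|[_ nB]]; first by rewrite eq_sym.
    by apply: contraNneq nB => ->; rewrite setUC.
  apply: early_or_late => //.
  - by rewrite in_setU1 negb_or eq_sym wu.
  - by rewrite -ltnS; apply: leq_trans c3 (card_setC_U1 _ _).
  - by move=> v; rewrite in_setU1 => /orP[/eqP->|/Bu'//]; rewrite eqxx.
right; exists x, z.
have c2 : #|~: X| <= 2.
  by apply: leq_trans (subset_leq_card UX) _; rewrite cards2; case: eqP.
have sh : shield u X = z.
  rewrite /shield c2; case: pickP => [y|/(_ z)]; last by rewrite !inE zu zX.
  rewrite in_setD1 => /andP[yu /(subsetP UX)]; rewrite !inE (negbTE yu).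
  by move/eqP.
have zp : z != wpos s by apply: contraNneq zX => ->.
have claimed : [set z; wpos s] \in bedges s'.
  rewrite /s' /= sh; apply: claim_claims zp _.
  by apply/negP => /Wz[]; rewrite !inE eqxx.
have wz : w != z.
  case: w1 => [->|[_ nB]]; first by rewrite eq_sym.
  by apply: contraNneq nB => ->; rewrite setUC.
have Bu' v : v \notin [set u; x; z] -> [set u; v] \in bedges s'.
  by move/Bu => h; rewrite /s' /= in_setU h orbT.
split=> //.
- by rewrite in_setU1 negb_or eq_sym wz.
- by apply: subset_trans UX; rewrite setCS subsetUr.
move=> e; rewrite /=; case: w1 => [->|[wp nB]]; first by rewrite eqxx => /Wz.
rewrite (negbTE wp) in_setU1 => /orP[/eqP->|/Wz//]; split.
  by rewrite !inE negb_or zp eq_sym.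
rewrite !inE => /orP[]/eqP uE.
  have : w \in [set u; x; z] by apply: contraT => /Bu'; rewrite uE (negbTE nB).
  by rewrite !inE (negbTE wz) uE (negbTE wp) orbF /= => /eqP ->.
have : wpos s \in [set u; x; z].
  by apply: contraT => /Bu'; rewrite uE setUC (negbTE nB).
rewrite !inE eq_sym [wpos s == z]eq_sym (negbTE zp) uE (negbTE wp) orbF /=.
by move=> /eqP ->; rewrite setUC.
Qed.

(** In the early phase more than two vertices are unvisited. In the late phase [z] is isolated in
    Walker's graph, and on a cycle both neighbours of [u] would be [x]. *)
Lemma inv_cycle u s X c : inv u s X -> 2 < size c ->
  ucycle (adj (wedges s)) c -> size c <= n - 2.
Proof.
case=> pX sW el c3 /andP[cc uc].
have out (z1 z2 : 'I_n) : z1 != z2 -> z1 \notin c -> z2 \notin c -> size c <= n - 2.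
  move=> z12 z1c z2c; have u12 : uniq [:: z1, z2 & c].
    by rewrite /= inE negb_or z12 z1c z2c uc.
  have := max_card (mem [:: z1, z2 & c]); rewrite (card_uniqP u12) card_ord /=.
  by clear; lia.
have nx v : v \in c -> [set v; next c v] \in wedges s by move/(next_cycle cc).
have pv v : v \in c -> [set prev c v; v] \in wedges s by move/(prev_cycle cc).
case: el => [[cX _ _]|[x [z [zu zX UX Bu Wz]]]].
  have cX' z : z \notin X -> z \notin c.
    by apply: contra => /nx/sW/subsetP; apply; rewrite !inE eqxx.
  have [z1 z1X _] : exists2 z, z \in ~: X & z \notin set0.
    by apply: ex_notin; rewrite cards0; apply: leq_trans cX.
  have [z2 z2X z12] : exists2 z, z \in ~: X & z \notin [set z1].
    by apply: ex_notin; rewrite cards1; apply: leq_trans cX.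
  rewrite !in_setC in_set1 in z1X z2X z12.
  by apply: (out z2 z1) => //; exact: cX'.
apply: (out z u) => //.
  by apply/negP => /nx/Wz[]; rewrite !inE eqxx.
apply/negP => uc'; have := next_neq_prev uc uc' c3.
have [_ h1] := Wz _ (nx _ uc'); have [_ h2] := Wz _ (pv _ uc').
rewrite (set2_injr (h1 _)) ?inE ?eqxx //.
rewrite [[set prev c u; u]]setUC in h2.
by rewrite (set2_injr (h2 _)) ?inE ?eqxx.
Qed.

Lemma breaker_prevents : 3 < n -> breaker_can_prevent 1 Breaker
  (fun E => exists2 k : nat, n - 2 < k & @has_cycle n k E).
Proof.
move=> hn; exists shield_strategy => v0 p [p0 pS].
pose u := odflt v0 [pick u | u != v0].
have uv0 : u != v0.
  rewrite /u; case: pickP => [//|no].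
  have [z _] : exists2 z, z \in [set: 'I_n] & z \notin [set v0].
    by apply: ex_notin; rewrite cards1 cardsT card_ord; move: hn; clear; lia.
  by rewrite in_set1 no.
pose X t := visited (history p t).
have XS t : X t.+1 = wpos (p t.+1) |: X t.
  apply/setP => x; rewrite /X /visited /history (mkseqS p t.+1) map_rcons.
  by rewrite in_setU1 !in_set mem_rcons in_cons.
have tauE t : shield_strategy (history p t) = claim (p t) [set shield u (X t); wpos (p t)].
  rewrite /shield_strategy /X.
  have -> : history p t = p 0 :: behead (history p t) by rewrite /history /mkseq.
  by rewrite -[last _ _]/(last (p 0) (p 0 :: behead (history p t))) -[p 0 :: _]/(history p t)
     last_history {1 2}p0.
split.
  by move=> t _; rewrite tauE; exact: claim_legal.
have turnB j : turn Breaker j.*2 = Breaker by rewrite /turn odd_double.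
have turnW j : turn Breaker j.*2.+1 = Walker by rewrite /turn /= odd_double.
have main j : inv u (p j.*2) (X j.*2).
  elim: j => [|j IH].
    have X0 : X 0 = [set v0] by apply/setP => x; rewrite /X /visited /= p0 !inE.
    rewrite double0 X0 p0; split=> /=; first exact: set11.
      by move=> e; rewrite in_set0.
    left; split; rewrite ?in_set1 //=; last by move=> v; rewrite in_set1 => ->.
    by rewrite cardsC1 card_ord; move: hn; clear; lia.
  have := pS j.*2; rewrite turnB tauE => E1.
  have := pS j.*2.+1; rewrite turnW => -[w lw E2].
  rewrite doubleS XS E2 XS; rewrite E1 in lw *.
  have := inv_step IH lw; rewrite /=.
  (* Breaker's turn repeats Walker's position in the history and adds no visited vertex. *)
  suff -> : w |: (wpos (p j.*2) |: X j.*2) = w |: X j.*2 by [].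
  by rewrite (setUidPr (_ : [set wpos (p j.*2)] \subset _)) // sub1set; case: IH.
have even j k : n - 2 < k -> ~ has_cycle k (wedges (p j.*2)).
  move=> lt [k3 [c sc cc]]; have := inv_cycle (main j) (c := c); rewrite sc => /(_ k3 cc).
  by move: lt; clear; lia.
(* At an odd time Breaker has just moved, so Walker's graph is that of the preceding even time. *)
move=> t [k lt hc]; have := odd_double_half t; case: (odd t) => /= tE.
  apply: (even t./2 k lt); have := pS (t./2).*2.
  by rewrite turnB -add1n tE => E; rewrite E in hc.
by apply: (even t./2 k lt); rewrite -[(t./2).*2]add0n tE.
Qed.

End BreakerStrategy.

Theorem theorem1p1 :
  exists n0 : nat, forall n : nat, n0 <= n ->
    (forall first : player,
       @walker_can_create n 1 first (fun E => @has_cycle n (n - 2) E)) /\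
    @breaker_can_prevent n 1 Breaker
      (fun E => exists2 k : nat, n - 2 < k & @has_cycle n k E).
Proof.
exists (200 * 1000) => n hn; split; first by move=> first; exact: walker_creates.
by apply: breaker_prevents; move: hn; clear; lia.
Qed.
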